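(* Let $d \ge 0$ be an integer. For each $j \in [d+1]$ let $A_1^{(j)}, \dots, A_{d+1}^{(j)} \subseteq S^d$ be closed sets such that $S^d = \bigcup_{i} A_i^{(j)} \cup \bigcup_{i} (-A_i^{(j)})$. Suppose that $A_i^{(j)} \cap (-A_i^{(\ell)}) = \emptyset$ for all $i \in [d+1]$ and all $j, \ell \in [d+1]$ with $j \ne \ell$. Fix signs $s_1, \dots, s_{d+1} \in \{-1,+1\}$. Then there is a permutation $\pi$ of $[d+1]$ such that $\bigcap_{i=1}^{d+1} s_i A_i^{(\pi(i))} \ne \emptyset$.
   Context: $[n] = \{1,\dots,n\}$. $S^d$ is the unit sphere in $\mathbb{R}^{d+1}$. For $A \subseteq S^d$, $-A = \{-x : x \in A\}$, and for a sign $s \in \{-1,+1\}$, $sA = \{sx : x \in A\}$. *)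

(* Defs.v *)
From mathcomp Require Import all_boot all_order all_algebra.
From mathcomp Require Import all_classical all_reals all_analysis.

Set Implicit Arguments.
Unset Strict Implicit.
Unset Printing Implicit Defensive.

Import GRing.Theory Num.Theory numFieldNormedType.Exports.
Local Open Scope classical_set_scope.
Local Open Scope ring_scope.

(* The library norm on 'rV[R]_n is the sup norm, so the Euclidean unit sphere
   is written with the sum of squares; the topology on 'rV[R]_n is the usual
   one. *)
Definition sphere (R : realType) (d : nat) : set 'rV[R]_d.+1 :=
  [set x | \sum_(k < d.+1) x 0 k ^+ 2 = 1].

Definition oppset (R : realType) (n : nat) (A : set 'rV[R]_n) : set 'rV[R]_n :=
  [set - x | x in A].

Definition scaleset (R : realType) (n : nat) (s : R) (A : set 'rV[R]_n) :
  set 'rV[R]_n := [set s *: x | x in A].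

(* Main.v *)
Require Import Defs.
From mathcomp Require Import all_boot all_order all_algebra.
From mathcomp Require Import all_fingroup.
From mathcomp Require Import all_classical all_reals all_analysis.
From mathcomp Require Import zify ring.

Set Implicit Arguments.
Unset Strict Implicit.
Unset Printing Implicit Defensive.

Import Order.TTheory GRing.Theory Num.Theory numFieldNormedType.Exports.
Local Open Scope classical_set_scope.
Local Open Scope ring_scope.

(** Fix a fine cubical subdivision of the boundary of the cube [-2N, 2N]^(d+1),
    projected radially onto the sphere. The cells of this subdivision, ordered
    by inclusion, are the vertices of its barycentric subdivision, whose simplices
    are the flags of cells; a flag contains at most one cell of each dimension.
    Colour a cell by its dimension j in 0..d and label it by some (i, sign) such
    that its centre lies in sign A_i^(j); this can be done antipodally. Two
    distinct cells of a flag have distinct colours, so by the disjointness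
    hypothesis and compactness they never get opposite labels once N is large.

    A labelling of the centres by +-1, ..., +-(d+1) that is antipodal and has no
    edge with opposite labels is a simplicial odd map from the sphere to the
    boundary of the cross-polytope. Its degree is odd, so it hits every facet:
    every sign pattern s is realized by the labels s_i i of some maximal flag.
    The colours of the cells of this flag form the permutation; its cells shrink
    to a point as N grows, and compactness gives a common point of the sets
    s_i A_i^(pi(i)).

    The oddness of the degree is Ky Fan's lemma. The sign pattern may be taken
    alternating (relabel). Let phi_k be the mod 2 cochain supported on the
    k-simplices whose labels, sorted by index, have alternating signs beginning
    with +, and let T be the antipodal map. Then delta phi_(k-1) = phi_k + T phi_k
    ([parity_alternating_labels_deletions]). The k-sphere is h_k + T h_k for a
    hemisphere h_k with boundary the (k-1)-sphere ([parity_hemisphere_faces]).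
    Hence phi_k (S^k) = (phi_k + T phi_k)(h_k) = phi_(k-1)(S^(k-1)) = ... =
    phi_0 (S^0) = 1 ([odd_alternating_flags]). *)

(** * Alternating label sequences *)

Local Notation "\parity_ ( i <- r ) F" := (\big[addb/false]_(i <- r) F)
  (at level 36, i at level 50, r at level 50, F at level 36).

(** The facets of a simplex given by the list of its vertices, with repetition
    when vertices are repeated. *)
Fixpoint deletions (T : Type) (s : seq T) : seq (seq T) :=
  if s is x :: s' then s' :: [seq x :: u | u <- deletions s'] else [::].

Lemma deletions_map (T U : Type) (f : T -> U) s :
  deletions (map f s) = map (map f) (deletions s).
Proof. by elim: s => //= x s ->; rewrite -!map_comp. Qed.

Lemma deletions_subseq (T : eqType) (s u : seq T) :
  u \in deletions s -> subseq u s.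
Proof.
elim: s u => // x s IHs u; rewrite /= inE => /predU1P[->|]; first exact: subseq_cons.
by move=> /mapP[v /IHs vs ->] /=; rewrite eqxx.
Qed.

Lemma parity_deletions_rem (T : eqType) (chi : seq T -> bool) s :
    (forall u v, perm_eq u v -> chi u = chi v) ->
  \parity_(u <- deletions s) chi u = \parity_(x <- s) chi (rem x s).
Proof.
elim: s chi => [|y s IHs] chi chiP; first by rewrite !big_nil.
rewrite /= !big_cons eqxx big_map IHs => [|u v uv]; last first.
  by apply: chiP; rewrite perm_cons.
congr (_ (+) _); apply: eq_big_seq => x xs; apply: chiP.
by case: eqP => [->|//]; rewrite perm_sym perm_to_rem.
Qed.

Lemma parity_deletions_perm (T : eqType) (chi : seq T -> bool) s t :
    (forall u v, perm_eq u v -> chi u = chi v) -> perm_eq s t ->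
  \parity_(u <- deletions s) chi u = \parity_(u <- deletions t) chi u.
Proof.
move=> chiP st; rewrite !parity_deletions_rem // (perm_big _ st) /=.
apply: eq_big_seq => x xt; apply: chiP.
rewrite -(perm_cons x) -(permPl (perm_to_rem _)) ?(perm_mem st) //.
by rewrite -(permPr (perm_to_rem xt)).
Qed.

Fixpoint alternates (b : bool) (s : seq bool) : bool :=
  if s is x :: s' then (x == b) && alternates (~~ b) s' else true.

(** Removing an entry of a sequence other than the first keeps the first sign,
    and removing the first reverses the expected sign; an induction on the
    sequence then makes all contributions cancel except these two. *)
Lemma parity_alternates_deletions b s :
  \parity_(u <- deletions s) alternates b u = alternates b s (+) alternates (~~ b) s.
Proof.
elim: s b => [|x s IHs] b; first by rewrite big_nil.
rewrite /= big_cons big_map /=.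
have -> : \parity_(u <- deletions s) ((x == b) && alternates (~~ b) u) =
          (x == b) && \parity_(u <- deletions s) alternates (~~ b) u.
  by case: (x == b) => //=; rewrite big1.
by rewrite IHs negbK; case: x b => [] [] /=;
  move: (alternates true s) (alternates false s) => [] [].
Qed.

Lemma alternates_negb b s : alternates b (map negb s) = alternates (~~ b) s.
Proof. by elim: s b => //= x s IHs b; rewrite IHs; case: x b => [] []. Qed.

(** A label is a natural number: 2 i and 2 i + 1 encode +i and -i, so that the
    usual order sorts labels by index and parity is the sign. *)
Definition flip (l : nat) : nat := if odd l then l.-1 else l.+1.

Lemma flipK : involutive flip.
Proof. by move=> l; rewrite /flip; case: (boolP (odd l)) => ol; case: ifP; lia. Qed.

Lemma odd_flip l : odd (flip l) = ~~ odd l.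
Proof. by rewrite /flip; case: ifP; lia. Qed.

Definition noncomplementary (l : seq nat) := {in l &, forall x y, x != flip y}.

Definition alternating_labels (b : bool) (l : seq nat) : bool :=
  alternates b (map odd (sort leq l)).

Lemma alternating_labels_perm b l l' :
  perm_eq l l' -> alternating_labels b l = alternating_labels b l'.
Proof.
move=> ll'; congr alternates; congr map.
by apply/(perm_sortP leq_total leq_trans anti_leq).
Qed.

(** The coboundary formula delta phi = phi + T phi. Both sides only depend on
    the multiset of labels, so the labels may be assumed sorted; deleting an
    entry keeps them sorted and the formula becomes one about signs. *)
Lemma parity_alternating_labels_deletions b l :
  \parity_(u <- deletions l) alternating_labels b u =
  alternating_labels b l (+) alternating_labels (~~ b) l.
Proof.
rewrite (@parity_deletions_perm _ _ l (sort leq l)); last 2 first.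
- exact: alternating_labels_perm.
- by rewrite perm_sym perm_sort.
rewrite -parity_alternates_deletions deletions_map big_map.
apply: eq_big_seq => u /deletions_subseq us.
rewrite /alternating_labels sorted_sort //; first exact: leq_trans.
exact: (subseq_sorted leq_trans us (sort_sorted leq_total l)).
Qed.

(** Sorting commutes with the sign change because the order of two labels is
    decided by their indices unless they are opposite. *)
Lemma alternating_labels_flip b l :
  noncomplementary l -> alternating_labels b (map flip l) = alternating_labels (~~ b) l.
Proof.
move=> lP; rewrite /alternating_labels.
suff -> : sort leq (map flip l) = map flip (sort leq l).
  rewrite -alternates_negb -!map_comp; congr alternates.
  by apply: eq_map => x /=; rewrite odd_flip.
apply: (@sorted_eq _ leq) => //; first exact: leq_trans.
- exact: anti_leq.
- exact: (sort_sorted leq_total).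
- rewrite sorted_map.
  apply: (@sub_in_sorted _ (mem l) leq) (sort_sorted leq_total l).
    move=> x y xl yl xy; have := lP x y xl yl; move: xy; rewrite /= /flip.
    by do 2! case: ifP; lia.
  by apply/allP => x; rewrite mem_sort.
- by rewrite perm_sort perm_map // perm_sym perm_sort.
Qed.

(** * Cells of the cubical lattice and their flags *)

(** A cell is a list of integers: an even entry is a lattice coordinate, an odd
    entry x stands for the open interval (x - 1, x + 1). The list itself is the
    centre of the cell, and the number of odd entries is its dimension. *)
Definition oddz (x : int) : bool := odd `|x|%N.

Fixpoint faces (c : seq int) : seq (seq int) :=
  if c is x :: c' then
    (if oddz x then [:: x + 1 :: c'; x - 1 :: c'] else [::]) ++
    [seq x :: f | f <- faces c']
  else [::].

Lemma parity_faces_cons (g : seq int -> bool) (x : int) (c : seq int) :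
  \parity_(f <- faces (x :: c)) g f =
  (oddz x && (g (x + 1 :: c) (+) g (x - 1 :: c))) (+)
  \parity_(f <- faces c) g (x :: f).
Proof.
rewrite /= big_cat big_map; congr (_ (+) _).
by case: (oddz x); rewrite ?(big_cons, big_nil) /= ?addbF.
Qed.

Arguments faces : simpl never.

Lemma oddzD1 x : oddz (x + 1) = ~~ oddz x.
Proof. by rewrite /oddz; lia. Qed.

Lemma oddzB1 x : oddz (x - 1) = ~~ oddz x.
Proof. by rewrite /oddz; lia. Qed.

Lemma oddzN x : oddz (- x) = oddz x.
Proof. by rewrite /oddz; lia. Qed.

Lemma parity_faces_const b c : \parity_(f <- faces c) b = false.
Proof.
elim: c => [|x c IHc]; first by rewrite big_nil.
by rewrite parity_faces_cons IHc addbb andbF.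
Qed.

(** The identity dd = 0 modulo 2: two moves in different directions can be made
    in either order, and two moves in the same direction are impossible since a
    move makes its entry even. *)
Lemma parity_faces_faces (g : seq int -> bool) (c : seq int) :
  \parity_(f <- faces c) \parity_(e <- faces f) g e = false.
Proof.
elim: c g => [|x c IHc] g; first by rewrite big_nil.
rewrite parity_faces_cons.
under [X in _ (+) X]eq_bigr do rewrite parity_faces_cons.
rewrite big_split /= IHc addbF !parity_faces_cons oddzD1 oddzB1.
case: (oddz x) => /=; last by rewrite big1.
by rewrite big_split /= addbb.
Qed.

Definition negc (c : seq int) : seq int := map -%R c.

Lemma negcK : involutive negc.
Proof. by move=> c; rewrite /negc -map_comp map_id_in // => x _ /=; rewrite opprK. Qed.

Lemma parity_faces_neg (g : seq int -> bool) (c : seq int) :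
  \parity_(f <- faces (negc c)) g f = \parity_(f <- faces c) g (negc f).
Proof.
elim: c g => [|x c IHc] g; first by rewrite !big_nil.
rewrite [negc _]/= !parity_faces_cons IHc /= oddzN opprB opprD addbC [-x - 1]addrC.
by rewrite [X in _ && X]addbC [in LHS]addbC [1 - x]addrC [-1 - x]addrC.
Qed.

(** When [c] has dimension [k], these are all maximal flags under [c], largest
    cell first. *)
Fixpoint flags (k : nat) (c : seq int) : seq (seq (seq int)) :=
  if k is k'.+1 then [seq c :: t | f <- faces c, t <- flags k' f] else [:: [:: c]].

Lemma parity_flagsS (g : seq (seq int) -> bool) k c :
  \parity_(t <- flags k.+1 c) g t =
  \parity_(f <- faces c) \parity_(t <- flags k f) g (c :: t).
Proof. by rewrite /= big_allpairs_dep. Qed.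

Lemma parity_flags0 (g : seq (seq int) -> bool) (c : seq int) :
  \parity_(t <- flags 0 c) g t = g [:: c].
Proof. by rewrite big_seq1. Qed.

(** The barycentric subdivision is a chain map: in the boundary of the sum of all
    flags under [c], the simplices that still contain [c] cancel, because dd = 0
    when an intermediate cell is removed and because an edge has two ends when
    the last one is. *)
Lemma parity_flags_deletions (chi : seq (seq int) -> bool) k c :
  \parity_(t <- flags k.+1 c) \parity_(u <- deletions t) chi u =
  \parity_(f <- faces c) \parity_(t <- flags k f) chi t.
Proof.
elim: k c chi => [|k IHk] c chi; rewrite parity_flagsS.
  under eq_bigr do rewrite parity_flags0 /= 2!big_cons big_nil addbF.
  rewrite big_split /= parity_faces_const addbF.
  by apply: eq_bigr => f _; rewrite parity_flags0.
under eq_bigr => f _ do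
  (under eq_bigr do rewrite /= big_cons big_map; rewrite big_split /= -/(flags k.+1 f)
   (IHk f (fun u => chi (c :: u)))).
by rewrite big_split /= parity_faces_faces addbF.
Qed.

Lemma parity_flags_neg (g : seq (seq int) -> bool) k c :
  \parity_(t <- flags k (negc c)) g t = \parity_(t <- flags k c) g (map negc t).
Proof.
elim: k c g => [|k IHk] c g; first by rewrite !parity_flags0.
rewrite !parity_flagsS parity_faces_neg; apply: eq_bigr => f _; exact: IHk.
Qed.

Lemma parity_flags_cons0 (g : seq (seq int) -> bool) k c :
  \parity_(t <- flags k (0 :: c)) g t = \parity_(t <- flags k c) g (map (cons 0) t).
Proof.
elim: k c g => [|k IHk] c g; first by rewrite !parity_flags0.
by rewrite !parity_flagsS parity_faces_cons /=; apply: eq_bigr => f _; exact: IHk.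
Qed.

(** * Cubes, spheres and hemispheres as mod 2 chains *)

Definition odds (N : nat) : seq int := [seq j.*2.+1%:Z | j <- iota 0 N].

Lemma addb_telescope a b c : a (+) b (+) (c (+) a) = c (+) b.
Proof. by case: a b c => [] [] []. Qed.

Lemma parity_odds N (g : int -> bool) :
  \parity_(x <- odds N) (g (x + 1) (+) g (x - 1)) = g N.*2%:Z (+) g 0.
Proof.
rewrite big_map; elim: N => [|N IHN]; first by rewrite big_nil addbb.
rewrite -addn1 iotaD big_cat IHN big_seq1 /= add0n addn1.
have -> : N.*2.+1%:Z + 1 = N.+1.*2%:Z by rewrite -PoszD addn1.
have -> : N.*2.+1%:Z - 1 = N.*2%:Z by rewrite -addn1 PoszD addrK.
exact: addb_telescope.
Qed.

Lemma parity_odds_neg N (g : int -> bool) :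
  \parity_(x <- odds N) (g (- x + 1) (+) g (- x - 1)) = g 0 (+) g (- N.*2%:Z).
Proof.
rewrite addbC -[in g 0]oppr0 -(parity_odds N (fun x => g (- x))).
by apply: eq_bigr => x _; rewrite opprB opprD addbC [1 - x]addrC.
Qed.

Lemma oddz_odds N x : x \in odds N -> oddz x.
Proof. by move=> /mapP[j _ ->]; rewrite /oddz; lia. Qed.

Fixpoint cube (N k : nat) : seq (seq int) :=
  if k is k'.+1 then
    [seq x :: c | x <- odds N ++ map -%R (odds N), c <- cube N k'] else [:: [::]].

(** The chain B x {2N} + S x [0, 2N]: a cube and its boundary sphere give the
    upper hemisphere of the next sphere, with the new coordinate as height. *)
Definition capped_cylinder (N : nat) (B S : seq (seq int)) : seq (seq int) :=
  [seq N.*2%:Z :: c | c <- B] ++ [seq x :: c | x <- odds N, c <- S].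

Fixpoint sphere_chain (N k : nat) : seq (seq int) :=
  if k is k'.+1 then
    let H := capped_cylinder N (cube N k') (sphere_chain N k') in H ++ map negc H
  else [::].

Definition hemisphere (N k : nat) := capped_cylinder N (cube N k) (sphere_chain N k).

Lemma sphere_chainS N k :
  sphere_chain N k.+1 = hemisphere N k ++ map negc (hemisphere N k).
Proof. by []. Qed.

Lemma parity_hemisphere N k (g : seq int -> bool) :
  \parity_(c <- hemisphere N k) g c =
  \parity_(c <- cube N k) g (N.*2%:Z :: c) (+)
  \parity_(x <- odds N) \parity_(c <- sphere_chain N k) g (x :: c).
Proof. by rewrite big_cat big_map big_allpairs_dep. Qed.

Lemma parity_cubeS N k (g : seq int -> bool) :
  \parity_(c <- cube N k.+1) g c =
  \parity_(x <- odds N) \parity_(c <- cube N k) g (x :: c) (+)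
  \parity_(x <- odds N) \parity_(c <- cube N k) g (- x :: c).
Proof.
rewrite big_allpairs_dep big_cat; congr (_ (+) _).
by rewrite (big_map -%R xpredT (fun x => \parity_(c <- cube N k) g (x :: c))).
Qed.

Lemma parity_cube_neg N k (g : seq int -> bool) :
  \parity_(c <- cube N k) g (negc c) = \parity_(c <- cube N k) g c.
Proof.
elim: k g => [|k IHk] g; first by rewrite !big_seq1.
rewrite !parity_cubeS addbC /=; congr (_ (+) _).
  by apply: eq_bigr => x _; rewrite -[RHS]IHk; apply: eq_bigr => c _; rewrite opprK.
by apply: eq_bigr => x _; rewrite -[RHS]IHk.
Qed.

Lemma parity_sphere_neg N k (g : seq int -> bool) :
  \parity_(c <- sphere_chain N k) g (negc c) = \parity_(c <- sphere_chain N k) g c.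
Proof.
case: k => [|k]; first by rewrite !big_nil.
rewrite sphere_chainS [LHS]big_cat [RHS]big_cat !(big_map negc) /= addbC.
congr (_ (+) _).
by apply: eq_bigr => c _; rewrite negcK.
Qed.

Lemma addb_cancel a z s b t :
  a (+) z (+) s (+) (z (+) b (+) t) = a (+) s (+) (b (+) t).
Proof. by case: a z s b t => [] [] [] [] []. Qed.

(** The sphere, built from two antipodal hemispheres, is the boundary of the
    cube. In each direction the sum over the unit intervals telescopes to the
    end points, and the equatorial contributions of both halves cancel. *)
Lemma parity_cube_faces N k (g : seq int -> bool) :
  \parity_(c <- cube N k) \parity_(f <- faces c) g f =
  \parity_(c <- sphere_chain N k) g c.
Proof.
elim: k g => [|k IHk] g; first by rewrite big_seq1 !big_nil.
rewrite parity_cubeS.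
have half (sgn : int -> int) : (forall x, oddz (sgn x) = oddz x) ->
  \parity_(x <- odds N) \parity_(c <- cube N k) \parity_(f <- faces (sgn x :: c)) g f =
  \parity_(c <- cube N k) \parity_(x <- odds N)
     (g (sgn x + 1 :: c) (+) g (sgn x - 1 :: c)) (+)
  \parity_(x <- odds N) \parity_(c <- sphere_chain N k) g (sgn x :: c).
  move=> sP; rewrite exchange_big /= [RHS]addbC.
  rewrite -(eq_bigr _ (fun x _ => IHk (fun c => g (sgn x :: c)))).
  rewrite [X in _ = X (+) _]exchange_big /= -big_split; apply: eq_bigr => c _ /=.
  rewrite -big_split; apply: eq_big_seq => x /oddz_odds xP /=.
  by rewrite parity_faces_cons sP xP /= addbC.
rewrite (half id) // (half -%R); last exact: oddzN.
under eq_bigr do rewrite (parity_odds N (fun x => g (x :: _))).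
under [X in _ (+) (X (+) _)]eq_bigr do
  rewrite (parity_odds_neg N (fun x => g (x :: _))).
rewrite !big_split sphere_chainS [RHS]big_cat (big_map negc) !parity_hemisphere /=.
rewrite [X in _ = _ (+) (X (+) _)](parity_cube_neg N k (fun c => g (- N.*2%:Z :: c))).
under [X in _ = _ (+) (_ (+) X)]eq_bigr do
  rewrite (parity_sphere_neg N k (fun c => g (- _ :: c))).
exact: addb_cancel.
Qed.

Lemma parity_sphere_faces N k (g : seq int -> bool) :
  \parity_(c <- sphere_chain N k) \parity_(f <- faces c) g f = false.
Proof.
rewrite -parity_cube_faces.
by under eq_bigr do rewrite parity_faces_faces; rewrite big1.
Qed.

Lemma oddz_double N : oddz N.*2%:Z = false.
Proof. by rewrite /oddz /= odd_double. Qed.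

(** The hemisphere B x {2N} + S x [0, 2N] has boundary S x {0}: both the boundary
    of the cap and the top of the cylinder give S x {2N}. *)
Lemma parity_hemisphere_faces N k (g : seq int -> bool) :
  \parity_(c <- hemisphere N k) \parity_(f <- faces c) g f =
  \parity_(c <- sphere_chain N k) g (0 :: c).
Proof.
rewrite parity_hemisphere.
under eq_bigr do rewrite parity_faces_cons oddz_double.
rewrite /= (parity_cube_faces N k (fun f => g (N.*2%:Z :: f))).
have -> : \parity_(x <- odds N) \parity_(c <- sphere_chain N k)
            \parity_(f <- faces (x :: c)) g f =
  \parity_(c <- sphere_chain N k) \parity_(x <- odds N)
     (g (x + 1 :: c) (+) g (x - 1 :: c)).
  rewrite [RHS]exchange_big /=; apply: eq_big_seq => x /oddz_odds xP.
  under eq_bigr do rewrite parity_faces_cons xP andTb.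
  by rewrite big_split /= (parity_sphere_faces N k (fun f => g (x :: f))) addbF.
under [X in _ (+) X]eq_bigr do rewrite (parity_odds N (fun x => g (x :: _))).
by rewrite big_split /= addKb.
Qed.

(** * Incidence of cells *)

(** Inclusion of closed cells in one coordinate: a point [x] is below the
    interval [y] when it is one of its ends. *)
Definition cle1 (x y : int) : bool := (x == y) || (oddz y && ~~ oddz x && (`|x - y| == 1)).

Definition cell_le (c e : seq int) : bool := all2 cle1 c e.

Definition rank (c : seq int) : nat := count oddz c.

Lemma cell_le_refl c : cell_le c c.
Proof. by elim: c => //= x c; rewrite /cell_le /= /cle1 eqxx. Qed.

Lemma cle1_trans : transitive cle1.
Proof.
move=> y x z /predU1P[->//|/andP[/andP[oy ox] xy]].
case/predU1P => [<-|/andP[/andP[oz]]]; last by rewrite oy.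
by rewrite /cle1 oy ox xy orbT.
Qed.

Lemma cell_le_trans : transitive cell_le.
Proof.
elim=> [|y ys IHy] [|x xs] [|z zs] //=; rewrite /cell_le /=.
case/andP => xy xys /andP[yz yzs].
by apply/andP; split; [exact: cle1_trans xy yz|exact: IHy xys yzs].
Qed.

Lemma cell_le_rank c e : cell_le c e -> c != e -> (rank c < rank e)%N.
Proof.
have cle1_odd x y : cle1 x y -> (oddz x <= oddz y)%N.
  by case/predU1P => [->//|/andP[/andP[-> /negbTE->]]].
have le : forall c e, cell_le c e -> (rank c <= rank e)%N.
  elim=> [|x xs IHx] [|y ys] //=; rewrite /cell_le /= => /andP[xy /IHx xys].
  by rewrite /rank /= leq_add // cle1_odd.
elim: c e => [|x xs IHx] [|y ys] //=; rewrite /cell_le /= => /andP[xy xys].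
rewrite eqseq_cons negb_and /rank /=.
have [exy /=|nxy _] := eqVneq x y.
  by move=> xsys; rewrite -addnS leq_add ?cle1_odd // IHx.
rewrite -addSn leq_add ?le //; case/predU1P: xy nxy => [->|]; first by rewrite eqxx.
by case/andP => /andP[-> /negbTE->].
Qed.

Lemma faces_le c f : f \in faces c -> cell_le f c.
Proof.
elim: c f => [|x c IHc] f //; rewrite /faces -/faces mem_cat => /orP[].
  case: ifP => // ox; rewrite !inE => /orP[] /eqP ->; rewrite /cell_le /=;
    rewrite -/(cell_le c c) cell_le_refl andbT /cle1 ox ?oddzD1 ?oddzB1 ox /=.
  - by rewrite addrAC subrr add0r normr1 eqxx orbT.
  - by rewrite addrAC subrr add0r normrN normr1 eqxx orbT.
by move=> /mapP[g /IHc gc ->]; rewrite /cell_le /= /cle1 eqxx.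
Qed.

(** Cells of the boundary of the cube [-2N, 2N]^k: since 2N is even, an entry of
    modulus 2N confines the cell to a face of the cube. *)
Definition on_boundary (N k : nat) (c : seq int) : bool :=
  [&& size c == k, all (fun x : int => `|x| <= N.*2)%N c &
      has (fun x : int => `|x| == N.*2)%N c].

Lemma on_boundary_le N k c e :
  cell_le c e -> on_boundary N k e -> on_boundary N k c.
Proof.
have size_le : forall c e, cell_le c e -> size c = size e.
  by move=> x y; rewrite /cell_le all2E => /andP[/eqP].
move=> ce /and3P[/eqP se ae he]; apply/and3P; split.
- by rewrite (size_le _ _ ce) se.
- elim: c e ce ae {se he} => [|x c IHc] [|y e] //; rewrite /cell_le /=.
  case/andP => xy ce /andP[yN eN]; rewrite (IHc _ ce eN) andbT.
  by move: xy yN; rewrite /cle1 /oddz; lia.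
- elim: c e ce he {se ae} => [|x c IHc] [|y e] //; rewrite /cell_le /=.
  case/andP => xy ce /orP[yN|eN]; last by rewrite (IHc _ ce eN) orbT.
  by move: xy yN; rewrite /cle1 /oddz; lia.
Qed.

Lemma on_boundary_neg N k c : on_boundary N k (negc c) = on_boundary N k c.
Proof.
rewrite /on_boundary size_map all_map has_map; congr [&& _, _ & _].
  by apply: eq_all => x /=; rewrite abszN.
by apply: eq_has => x /=; rewrite abszN.
Qed.

Lemma sphere_chain_boundary N k c : c \in sphere_chain N k -> on_boundary N k c.
Proof.
have oddsN x : x \in odds N -> (`|x| <= N.*2)%N.
  by move=> /mapP[j]; rewrite mem_iota => jN ->; lia.
have cubeP m e : e \in cube N m ->
    (size e == m) && all (fun x : int => `|x| <= N.*2)%N e.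
  elim: m e => [|m IHm] e; first by rewrite inE => /eqP->.
  case/allpairsP => -[x e'] /= [xN /IHm /andP[/eqP se ae] ->] /=.
  rewrite se eqxx ae andbT; move: xN; rewrite mem_cat => /orP[/oddsN//|].
  by move=> /mapP[y /oddsN yN ->]; rewrite abszN.
elim: k c => [//|k IHk] c; rewrite sphere_chainS mem_cat.
have hP e : e \in hemisphere N k -> on_boundary N k.+1 e.
  rewrite mem_cat => /orP[/mapP[e' /cubeP/andP[/eqP se ae] ->]|].
    by rewrite /on_boundary /= se ae !eqxx leqnn.
  case/allpairsP => -[x e'] /= [/oddsN xN /IHk /and3P[/eqP se ae he] ->].
  by rewrite /on_boundary /= se ae he xN orbT eqxx.
by case/orP => [/hP//|/mapP[e /hP eP ->]]; rewrite on_boundary_neg.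
Qed.

Lemma flags_size k c t : t \in flags k c -> size t = k.+1.
Proof.
elim: k c t => [|k IHk] c t; first by rewrite inE => /eqP->.
by case/allpairsPdep => f [u] [_ /IHk su ->] /=; rewrite su.
Qed.

Lemma flags_le k c t : t \in flags k c -> {in t, forall e, cell_le e c}.
Proof.
elim: k c t => [|k IHk] c t.
  by rewrite inE => /eqP-> e; rewrite inE => /eqP->; exact: cell_le_refl.
case/allpairsPdep => f [u] [/faces_le fc /IHk uf ->] e; rewrite inE.
by move=> /predU1P[->|/uf ef]; [exact: cell_le_refl|exact: cell_le_trans fc].
Qed.

Lemma flags_comparable k c t :
  t \in flags k c -> {in t &, forall x y, cell_le x y || cell_le y x}.
Proof.
elim: k c t => [|k IHk] c t.
  by rewrite inE => /eqP-> x y; rewrite !inE => /eqP-> /eqP->; rewrite cell_le_refl.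
move=> tP; have := flags_le tP; move: tP.
case/allpairsPdep => f [u] [_ /IHk uP ->] cP x y xu yu.
have /predU1P[->|xu'] : (x == c) || (x \in u) by rewrite -in_cons.
  by rewrite cP ?orbT.
have /predU1P[->|yu'] : (y == c) || (y \in u) by rewrite -in_cons.
  by rewrite cP.
exact: uP.
Qed.

(** * Ky Fan's lemma *)

Definition flag_parity (lam : seq int -> nat) (k : nat) (c : seq int) : bool :=
  \parity_(t <- flags k c) alternating_labels false (map lam t).

(** Ky Fan's lemma. The sum over the sphere is the sum of phi + T phi over a
    hemisphere, which the coboundary formula turns into a sum over the boundary
    of the hemisphere, the equator; the equator is a sphere with one coordinate
    less, labelled by restriction. *)
Theorem odd_alternating_flags N k (lam : seq int -> nat) :
    (forall c, on_boundary N k.+1 c -> lam (negc c) = flip (lam c)) ->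
    (forall c e, on_boundary N k.+1 c -> on_boundary N k.+1 e ->
       cell_le c e -> lam c != flip (lam e)) ->
  \parity_(c <- sphere_chain N k.+1) flag_parity lam k c = true.
Proof.
elim: k lam => [|k IHk] lam lamN lamC.
  rewrite sphere_chainS [LHS]big_cat (big_map negc) parity_hemisphere.
  rewrite (parity_hemisphere N 0 (fun c => flag_parity lam 0 (negc c))) /=.
  rewrite [X in _ (+) X (+) _]big1 => [|x _]; last by rewrite big_nil.
  rewrite [X in _ (+) (_ (+) X)]big1 => [|x _]; last by rewrite big_nil.
  rewrite !big_seq1 !addbF /flag_parity !parity_flags0 /=.
  rewrite (lamN [:: N.*2%:Z]); last by rewrite /on_boundary /= !leqnn eqxx.
  by rewrite /alternating_labels /= odd_flip; case: odd.
have flag_neg c : on_boundary N k.+2 c ->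
    flag_parity lam k.+1 (negc c) =
    \parity_(t <- flags k.+1 c) alternating_labels true (map lam t).
  move=> cP; rewrite /flag_parity parity_flags_neg; apply: eq_big_seq => t tP.
  have tB : {in t, forall e, on_boundary N k.+2 e}.
    by move=> e et; apply: on_boundary_le cP; exact: flags_le tP _ et.
  rewrite -map_comp -[true]/(~~ false) -alternating_labels_flip.
    rewrite -map_comp; congr alternating_labels; apply/eq_in_map => e et /=.
    by rewrite lamN ?tB.
  move=> _ _ /mapP[x xt ->] /mapP[y yt ->].
  have /orP[xy|yx] := flags_comparable tP xt yt; first by apply: lamC; rewrite ?tB.
  apply: contra (lamC _ _ (tB _ yt) (tB _ xt) yx) => /eqP->.
  by rewrite flipK.
have cofaces c : on_boundary N k.+2 c ->
    flag_parity lam k.+1 c (+) flag_parity lam k.+1 (negc c) =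
    \parity_(f <- faces c) flag_parity lam k f.
  move=> cP; rewrite flag_neg // -big_split /=.
  rewrite -(parity_flags_deletions (fun t => alternating_labels false (map lam t))).
  apply: eq_bigr => t _; rewrite -[true]/(~~ false) -parity_alternating_labels_deletions.
  by rewrite deletions_map big_map.
rewrite sphere_chainS [LHS]big_cat (big_map negc) -[LHS]big_split /=.
have -> : \parity_(c <- hemisphere N k.+1)
    (flag_parity lam k.+1 c (+) flag_parity lam k.+1 (negc c)) =
    \parity_(c <- hemisphere N k.+1) \parity_(f <- faces c) flag_parity lam k f.
  apply: eq_big_seq => c cP; apply: cofaces; apply: sphere_chain_boundary.
  by rewrite sphere_chainS mem_cat cP.
rewrite parity_hemisphere_faces.
have boundary0 c : on_boundary N k.+1 c -> on_boundary N k.+2 (0 :: c).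
  by case/and3P => sc ac hc; rewrite /on_boundary /= eqSS sc ac hc orbT.
apply: etrans (IHk (fun c => lam (0 :: c)) _ _).
- apply: eq_bigr => c _; rewrite /flag_parity parity_flags_cons0.
  by apply: eq_bigr => t _; rewrite -map_comp.
- by move=> c cP; rewrite -lamN ?boundary0 //= oppr0.
- move=> c e cP eP ce; apply: lamC => //; exact: boundary0.
Qed.

Lemma alternates_nth s b i : alternates b s -> (i < size s)%N ->
  nth false s i = b (+) odd i.
Proof.
elim: s b i => [//|x s IHs] b [|i] /= /andP[/eqP xb sP].
  by rewrite xb addbF.
by rewrite ltnS => /(IHs _ _ sP) ->; rewrite addNb addbN.
Qed.

(** With n labels of n possible indices, alternation of the signs forces each
    index to occur exactly once: consecutive sorted labels have different signs,
    hence, not being opposite, increasing indices. *)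
Lemma alternating_labels_full n l : size l = n -> noncomplementary l ->
    {in l, forall x, x < n.*2}%N -> alternating_labels false l ->
  forall i, (i < n)%N -> (i.*2 + odd i)%N \in l.
Proof.
move=> sl lC ln alt i ltin; set s := sort leq l.
have ss : size s = n by rewrite size_sort.
have altP j : (j < n)%N -> odd (nth 0%N s j) = odd j.
  move=> jn; have := @alternates_nth _ _ j alt.
  by rewrite size_map -/s ss => /(_ jn); rewrite (nth_map 0%N) ?ss.
have sS : sorted leq s by exact: sort_sorted leq_total _.
have mems j : (j < n)%N -> nth 0%N s j \in l.
  by move=> jn; rewrite -(mem_sort leq) mem_nth // ss.
have step j : (j.+1 < n)%N -> ((nth 0%N s j)./2 < (nth 0%N s j.+1)./2)%N.
  move=> jn; have jn' := ltnW jn.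
  have le : (nth 0%N s j <= nth 0%N s j.+1)%N.
    by move/(sortedP 0%N): sS; apply; rewrite ss.
  have := lC _ _ (mems _ jn) (mems _ jn'); rewrite /flip.
  have := altP _ jn; have := altP _ jn'; rewrite /=.
  by case: ifP; lia.
(* The halves increase strictly and lie in 0..n-1, hence are 0, 1, ..., n-1. *)
have lower j : (j < n)%N -> (j <= (nth 0%N s j)./2)%N.
  elim: j => [//|j IHj] jn; have := step _ jn; have := IHj (ltnW jn); lia.
have upper j : (j < n)%N -> ((nth 0%N s (n - j.+1))./2 < n - j)%N.
  elim: j => [|j IHj] jn.
    have : (nth 0%N s (n - 1) < n.*2)%N by apply/ln/mems; lia.
    by lia.
  have := IHj (ltnW jn); have := @step (n - j.+2)%N.
  by rewrite (_ : (n - j.+2).+1 = n - j.+1)%N; [lia|lia].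
have half : (nth 0%N s i)./2 = i.
  have := lower _ ltin; have := @upper (n - i.+1)%N.
  rewrite (_ : n - (n - i.+1).+1 = i)%N; [lia|lia].
have := altP _ ltin => oi; have := mems _ ltin.
by congr (_ \in l); rewrite -(odd_double_half (nth 0%N s i)) half oi addnC.
Qed.

(** An odd number of alternating flags is at least one, and a maximal flag has as
    many cells as there are indices, so all of them occur. *)
Lemma exists_full_flag N d (lam : seq int -> nat) :
    (forall c, on_boundary N d.+1 c -> lam (negc c) = flip (lam c)) ->
    (forall c e, on_boundary N d.+1 c -> on_boundary N d.+1 e ->
       cell_le c e -> lam c != flip (lam e)) ->
    (forall c, lam c < d.+1.*2)%N ->
  exists t : seq (seq int),
    [/\ {in t, forall c, on_boundary N d.+1 c},
        {in t &, forall c e, cell_le c e || cell_le e c} &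
        forall i, (i < d.+1)%N -> exists2 c, c \in t & lam c = (i.*2 + odd i)%N].
Proof.
move=> lamN lamC lamlt; have := odd_alternating_flags lamN lamC.
case: (boolP (has (fun c => flag_parity lam d c) (sphere_chain N d.+1))); last first.
  by move=> /hasPn h; rewrite big1_seq // => c /andP[_ /h/negbTE].
move=> /hasP[c cS cflag] _; move: cflag; rewrite /flag_parity.
case: (boolP (has (fun t => alternating_labels false (map lam t)) (flags d c))); last first.
  by move=> /hasPn h; rewrite big1_seq // => t /andP[_ /h/negbTE].
move=> /hasP[t tc talt] _; exists t.
have tB : {in t, forall e, on_boundary N d.+1 e}.
  move=> e /(flags_le tc) ec; apply: on_boundary_le ec _.
  exact: sphere_chain_boundary.
have tcmp := flags_comparable tc.
split => // i id.
have : (i.*2 + odd i)%N \in map lam t.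
  apply: (alternating_labels_full _ _ _ talt id).
  - by rewrite size_map (flags_size tc).
  - move=> _ _ /mapP[x xt ->] /mapP[y yt ->].
    have /orP[xy|yx] := tcmp _ _ xt yt; first by apply: lamC => //; exact: tB.
    apply: contra (lamC _ _ (tB _ yt) (tB _ xt) yx) => /eqP->.
    by rewrite flipK.
  - by move=> _ /mapP[x _ ->].
by move=> /mapP[e et ->]; exists e.
Qed.

(** * Compactness and radial projection *)

Definition separated (R : realType) (V : normedModType R) (I : Type)
    (K : set V) (F : I -> set V) (e : R) : Prop :=
  forall x (y : I -> V), K x -> (forall i, F i (y i)) -> exists i, e <= `|x - y i|.

(** A Lebesgue number argument: near each point of [K] one of the closed sets is
    missed by a margin, and compactness makes the margin uniform. *)
Lemma closed_family_separated (R : realType) (V : normedModType R) (I : finType)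
    (K : set V) (F : I -> set V) :
    compact K -> (forall i, closed (F i)) -> \bigcap_i F i = set0 ->
  \forall N \near \oo, separated K F N.+1%:R^-1.
Proof.
move=> Kc Fc F0.
pose P (N : nat) (x : V) := forall y : I -> V, (forall i, F i (y i)) ->
  exists i, N.+1%:R^-1 <= `|x - y i|.
suff : \forall N \near \oo, K `<=` P N.
  by apply: filterS => N KP x y Kx yF; exact: KP.
apply: (compact_near_coveringP K).1 => // x Kx.
have [i nFx] : exists i, ~ F i x.
  by apply/existsNP => Fx; have : (\bigcap_i F i) x by []; rewrite F0.
have : nbhs x (~` F i) by apply: open_nbhs_nbhs; split => //; exact: closed_openC.
move=> /nbhs_ballP[e /= e0 eF].
have e20 : 0 < e / 2 by rewrite divr_gt0.
exists (ball x (e / 2), [set N | N.+1%:R^-1 < e / 2]).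
  by split; [exact: nbhsx_ballx|exact: (near_infty_natSinv_lt (PosNum e20))].
move=> [x' N] /= [xx' Ne] y yF; exists i; rewrite leNgt; apply/negP => x'y.
apply: (eF (y i)) (yF i); rewrite [e]splitr.
apply: ball_triangle xx' _; rewrite -ball_normE /=; exact: lt_trans Ne.
Qed.

Section Cells.
Variables (R : realType) (d : nat).
Local Notation V := 'rV[R]_d.+1.

Definition cell_vec (c : seq int) : V := \row_i (nth 0 c i)%:~R.

Definition l2norm (v : V) : R := Num.sqrt (\sum_k v 0 k ^+ 2).

Definition normalize (v : V) : V := (l2norm v)^-1 *: v.

Lemma sum_sqr_ge0 (v : V) : 0 <= \sum_k v 0 k ^+ 2.
Proof. by apply: sumr_ge0 => k _; exact: sqr_ge0. Qed.

Lemma coord_le_l2norm (v : V) i : `|v 0 i| <= l2norm v.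
Proof.
rewrite -sqrtr_sqr ler_wsqrtr // (bigD1 i) //= lerDl.
by apply: sumr_ge0 => k _; exact: sqr_ge0.
Qed.

Lemma normalizeN (v : V) : normalize (- v) = - normalize v.
Proof.
rewrite /normalize scalerN; congr (- (_^-1 *: _)); congr Num.sqrt.
by apply: eq_bigr => k _; rewrite mxE sqrrN.
Qed.

Lemma normalize_sphere (v : V) : 0 < l2norm v -> @sphere R d (normalize v).
Proof.
move=> v0; rewrite /sphere /=; under eq_bigr do rewrite mxE exprMn.
rewrite -mulr_sumr -(sqr_sqrtr (sum_sqr_ge0 v)) -/(l2norm v) -exprMn mulVf ?expr1n //.
exact: lt0r_neq0.
Qed.

Lemma sphere_box (v : V) i : @sphere R d v -> `|v 0 i| <= 1.
Proof. by move=> vS; apply: le_trans (coord_le_l2norm v i) _; rewrite /l2norm vS sqrtr1. Qed.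

(** Normalization is Lipschitz far from the origin: with a, b the norms of v, w,
    v_i / a - w_i / b = ((v_i - w_i) + (w_i / b) (b - a)) / a, where b - a is
    bounded through b^2 - a^2, which avoids the triangle inequality for the
    Euclidean norm. In the constant, 1 comes from the coordinate i and d + 1 from
    b - a. *)
Lemma normalize_close (m : R) (v w : V) : 0 < m -> m <= l2norm v -> m <= l2norm w ->
    (forall i, `|v 0 i - w 0 i| <= 1) ->
  forall i, `|normalize v 0 i - normalize w 0 i| <= d.+2%:R / m.
Proof.
move=> m0 mv mw vw i; set a := l2norm v; set b := l2norm w.
have a0 : 0 < a by exact: lt_le_trans mv.
have b0 : 0 < b by exact: lt_le_trans mw.
have a2 : a ^+ 2 = \sum_k v 0 k ^+ 2 by rewrite sqr_sqrtr // sum_sqr_ge0.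
have b2 : b ^+ 2 = \sum_k w 0 k ^+ 2 by rewrite sqr_sqrtr // sum_sqr_ge0.
have ab : `|b - a| <= d.+1%:R.
  have ab0 : 0 < b + a by rewrite addr_gt0.
  rewrite -(ler_pM2r ab0) -[X in _ * X <= _](gtr0_norm ab0) -normrM -subr_sqr a2 b2.
  rewrite -sumrB; apply: le_trans (ler_norm_sum _ _ _) _.
  rewrite mulr_natl -[X in _ *+ X]card_ord -sumr_const.
  apply: ler_sum => k _; rewrite subr_sqr normrM -[b + a]mul1r.
  apply: ler_pM => //; first by rewrite distrC.
  by apply: le_trans (ler_normD _ _) _; rewrite lerD // coord_le_l2norm.
rewrite !mxE -/a -/b.
have -> : a^-1 * v 0 i - b^-1 * w 0 i =
    a^-1 * ((v 0 i - w 0 i) + (w 0 i / b) * (b - a)).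
  by field; rewrite !lt0r_neq0.
rewrite normrM mulrC ler_pM //.
  apply: le_trans (ler_normD _ _) _; rewrite -[d.+2]add1n natrD lerD //.
  rewrite normrM -[d.+1%:R]mul1r ler_pM // normrM normfV (gtr0_norm b0).
  by rewrite ler_pdivrMr // mul1r coord_le_l2norm.
by rewrite normfV (gtr0_norm a0) lef_pV2.
Qed.

Definition cell_pt (c : seq int) : V := normalize (cell_vec c).

Lemma cell_pt_neg c : cell_pt (negc c) = - cell_pt c.
Proof.
rewrite /cell_pt -normalizeN; congr normalize; apply/rowP => i; rewrite !mxE.
have [ic|ci] := ltnP i (size c); first by rewrite (nth_map 0) // rmorphN.
by rewrite !nth_default ?size_map // oppr0.
Qed.

Lemma cell_vec_l2norm N c : on_boundary N d.+1 c -> N.*2%:R <= l2norm (cell_vec c).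
Proof.
case/and3P => /eqP sc _ /(has_nthP 0)[j]; rewrite sc => jd /eqP cj.
apply: le_trans (coord_le_l2norm _ (Ordinal jd)).
by rewrite mxE /= -intr_norm -cj natr_absz.
Qed.

Lemma cell_pt_sphere N c : (0 < N)%N -> on_boundary N d.+1 c -> @sphere R d (cell_pt c).
Proof.
move=> N0 /cell_vec_l2norm cN; apply: normalize_sphere; apply: lt_le_trans cN.
by rewrite ltr0n double_gt0.
Qed.

Lemma cell_pt_close N c e : (0 < N)%N ->
    on_boundary (d.+2 * N) d.+1 c -> on_boundary (d.+2 * N) d.+1 e ->
    cell_le c e || cell_le e c ->
  `|cell_pt c - cell_pt e| < N%:R^-1.
Proof.
move=> N0 cB eB ce.
have entry a b : cell_le a b -> forall i, `|nth 0 a i - nth 0 b i| <= 1.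
  elim: a b => [|x a IHa] [|y b] //; rewrite /cell_le /=.
    by move=> _ i; rewrite nth_nil subrr normr0.
  case/andP => xy ab [|i] /=; last exact: IHa.
  by move: xy; rewrite /cle1 => /predU1P[->|/andP[_ /eqP->]//]; rewrite subrr normr0.
have vec i : `|cell_vec c 0 i - cell_vec e 0 i| <= 1.
  rewrite !mxE -rmorphB /= -intr_norm -[1]/(1%:~R) ler_int.
  by case/orP: ce => /entry; [exact|move/(_ i); rewrite distrC].
have m0 : 0 < (d.+2 * N).*2%:R :> R by rewrite ltr0n double_gt0 muln_gt0.
have close := normalize_close m0 (cell_vec_l2norm cB) (cell_vec_l2norm eB) vec.
have N0' : 0 < N%:R :> R by rewrite ltr0n.
rewrite [`|_|]mx_normrE; apply: bigmax_lt; first by rewrite invr_gt0.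
move=> [i j] _ /=; rewrite (ord1 i).
have -> (v w : 'rV[R]_d.+1) : (v - w) 0 j = v 0 j - w 0 j by rewrite !mxE.
apply: le_lt_trans (close j) _.
have -> : d.+2%:R / (d.+2 * N).*2%:R = N%:R^-1 / 2 :> R.
  have: d.+2%:R != 0 :> R by rewrite pnatr_eq0.
  rewrite -mul2n !natrM; move: (d.+2%:R : R) (N%:R : R) N0' => D M M0 D0.
  by field; rewrite D0 lt0r_neq0.
by rewrite ltr_pdivrMr // ltr_pMr ?invr_gt0 // ltr1n.
Qed.

End Cells.

(** * Antipodal labellings and the theorem *)

(** To choose labels antipodally, choose them on one cell of each antipodal pair
    (the one that comes first in an enumeration of all cells) and transport them
    to the other. *)
Lemma antipodal_choice (I : Type) (i0 : I) (B : seq int -> bool)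
    (Q : seq int -> I -> bool -> Prop) :
    (forall c, B (negc c) = B c) -> (forall c, B c -> negc c != c) ->
    (forall c i b, Q c i b -> Q (negc c) i (~~ b)) ->
    (forall c, B c -> exists i b, Q c i b) ->
  exists f : seq int -> I * bool, forall c, B c ->
    Q c (f c).1 (f c).2 /\ f (negc c) = ((f c).1, ~~ (f c).2).
Proof.
move=> BN nfix QN Qex.
have /choice[g gP] : forall c, exists l : I * bool, B c -> Q c l.1 l.2.
  move=> c; have [/Qex[i [b Qc]]|nB] := boolP (B c); first by exists (i, b).
  by exists (i0, false).
pose pos c := (pickle c < pickle (negc c))%N.
have posN c : B c -> pos (negc c) = ~~ pos c.
  move=> /nfix cN; rewrite /pos negcK -leqNgt ltn_neqAle.
  by rewrite (inj_eq (pcan_inj pickleK)) cN.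
exists (fun c => if pos c then g c else ((g (negc c)).1, ~~ (g (negc c)).2)) => c Bc.
rewrite posN // negcK; split; case: (pos c) => //=.
- exact: gP.
- by rewrite -[c in Q c]negcK; apply/QN/gP; rewrite BN.
- by rewrite negbK; case: (g _).
Qed.

Lemma on_boundary_neg_neq N k c : (0 < N)%N -> on_boundary N k c -> negc c != c.
Proof.
move=> N0 /and3P[_ _]; elim: c => //= x c IHc /orP[xN|/IHc cN]; last first.
  by rewrite /= eqseq_cons (negbTE cN) andbF.
by rewrite /= eqseq_cons negb_and; apply/orP; left; move: xN; lia.
Qed.

Lemma rank_neg c : rank (negc c) = rank c.
Proof. by rewrite /rank count_map; apply: eq_count => x /=; rewrite oddzN. Qed.

Lemma on_boundary_rank N k c : on_boundary N k c -> (rank c < k)%N.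
Proof.
move=> /and3P[/eqP <- _ hc]; rewrite /rank -(count_predC oddz c).
rewrite -[X in (X < _)%N]addn0 ltn_add2l -has_count.
by apply: sub_has hc => x /= /eqP xN; rewrite /oddz xN odd_double.
Qed.

Lemma closed_scaleset (R : realType) (n : nat) (a : R) (A : set 'rV[R]_n) :
  a = -1 \/ a = 1 -> closed A -> closed (scaleset a A).
Proof.
move=> a1 Ac; have aa : a * a = 1 by case: a1 => ->; rewrite ?mulr1 ?mulrNN ?mulr1.
have -> : scaleset a A = (fun x => a *: x) @^-1` A.
  apply/seteqP; split => [_ [x Ax <-]|x Ax] /=; first by rewrite scalerA aa scale1r.
  by exists (a *: x) => //; rewrite scalerA aa scale1r.
apply: preimage_closed => // x _; exact: scaler_continuous.
Qed.

Theorem theorem3p3 (R : realType) (d : nat)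
    (A : 'I_d.+1 -> 'I_d.+1 -> set 'rV[R]_d.+1)
    (A_sub : forall j i, A j i `<=` @sphere R d)
    (A_closed : forall j i, closed (A j i))
    (A_cover : forall j,
      @sphere R d = (\bigcup_i A j i) `|` (\bigcup_i oppset (A j i)))
    (A_disj : forall i j l, j != l -> A j i `&` oppset (A l i) = set0)
    (s : 'I_d.+1 -> R)
    (s_sign : forall i, s i = -1 \/ s i = 1) :
  exists p : {perm 'I_d.+1}, (\bigcap_i scaleset (s i) (A (p i) i)) !=set0.
Proof.
apply: contrapT => noperm.
have perm0 (p : {perm 'I_d.+1}) : \bigcap_i scaleset (s i) (A (p i) i) = set0.
  by apply/eqP/negPn/negP => /set0P ne; apply: noperm; exists p.
have sclosed j i : closed (scaleset (s i) (A j i)) by exact: closed_scaleset.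
have oclosed j i : closed (oppset (A j i)).
  have -> : oppset (A j i) = scaleset (-1) (A j i).
    by apply: eq_imagel => x _; rewrite scaleN1r.
  by apply: closed_scaleset => //; left.
pose K := [set v : 'rV[R]_d.+1 | forall i, `[(-1 : R), 1]%classic (v ord0 i)].
have Kc : compact K.
  exact: (@rV_compact R d.+1 (fun=> `[-1, 1]%classic) (fun=> @segment_compact R _ _)).
pose F (p : {perm 'I_d.+1}) i := scaleset (s i) (A (p i) i).
(* As a family indexed by booleans, A_i^(j) and -A_i^(l) come under the same
   separation lemma as the sets s_i A_i^(p(i)). *)
pose G (q : 'I_d.+1 * 'I_d.+1 * 'I_d.+1) (b : bool) :=
  if b then A q.1.1 q.2 else oppset (A q.1.2 q.2).
have sepF p : \forall M \near \oo, separated K (F p) M.+1%:R^-1.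
  by apply: closed_family_separated (perm0 p) => // i; exact: sclosed.
have sepG q : \forall M \near \oo, q.1.1 != q.1.2 -> separated K (G q) M.+1%:R^-1.
  have [_|jl] := eqVneq q.1.1 q.1.2; first by apply: nearW.
  suff : \forall M \near \oo, separated K (G q) M.+1%:R^-1.
    by apply: filterS => M sep _.
  apply: closed_family_separated => //; first by rewrite /G => -[].
  rewrite -subset0 -(A_disj q.2 _ _ jl) => x xP.
  by split; [exact: (xP true I)|exact: (xP false I)].
have [M [sepFM sepGM]] :=
  filter_ex (filterI (filter_forall _ sepF) (filter_forall _ sepG)).
(* Centres of comparable cells differ by at most 1 in each coordinate, so this
   mesh makes their projections closer than 1 / M.+1. *)
set N := (d.+2 * M.+1)%N.
have N0 : (0 < N)%N by [].
pose B := on_boundary N d.+1.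
pose u := @cell_pt R d.
pose color c : 'I_d.+1 := inord (rank c).
have uK c : B c -> K (u c).
  move=> cB i /=; rewrite in_itv /= -ler_norml; apply: sphere_box.
  exact: cell_pt_sphere cB.
have color_neq c e : B c -> B e -> cell_le c e || cell_le e c -> c != e ->
    color c != color e.
  move=> /on_boundary_rank rc /on_boundary_rank re ce ne.
  apply/eqP => /(congr1 val); rewrite /= !inordK //.
  case/orP: ce => /cell_le_rank; [move/(_ ne)|rewrite eq_sym => /(_ ne)]; lia.
(* The projections of the two cells are closer to each other than any points of
   A_i^(j) and -A_i^(l) with j <> l can be. *)
have separated_opp c e i : B c -> B e -> cell_le c e || cell_le e c -> c != e ->
    A (color c) i (u c) -> A (color e) i (- u e) -> False.
  move=> cB eB ce ne Ac Ae.
  have := sepGM (color c, color e, i) (color_neq _ _ cB eB ce ne).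
  move=> /(_ (u c) (fun b => if b then u c else u e) (uK _ cB)) [|b].
    by case=> //=; exists (- u e); rewrite ?opprK.
  rewrite leNgt => /negP; apply; case: b; last exact: cell_pt_close.
  by rewrite subrr normr0 invr_gt0 ltr0n.
pose Q c (i : 'I_d.+1) (b : bool) := A (color c) i ((-1) ^+ b *: u c).
have [f fP] : exists f : seq int -> 'I_d.+1 * bool, forall c, B c ->
    Q c (f c).1 (f c).2 /\ f (negc c) = ((f c).1, ~~ (f c).2).
  apply: (antipodal_choice ord0).
  - by move=> c; exact: on_boundary_neg.
  - by move=> c; exact: on_boundary_neg_neq.
  - move=> c i b; rewrite /Q /color rank_neg /u cell_pt_neg scalerN -scaleNr.
    by case: b; rewrite /= ?expr0 ?expr1 ?opprK.
  - move=> c /cell_pt_sphere cS; have := cS R N0; rewrite (A_cover (color c)).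
    move=> [[i _ ci]|[i _ [x xA xc]]]; exists i.
      by exists false; rewrite /Q expr0 scale1r.
    by exists true; rewrite /Q expr1 scaleN1r /u -xc opprK.
(* The sign is recorded relative to the target pattern s and then twisted by
   the parity of the index, so that an alternating flag realizes s. *)
pose neg i := s i == -1.
pose lam c := ((f c).1.*2 + ((f c).2 (+) neg (f c).1 (+) odd (f c).1))%N.
have [||//|t [tB tcmp tfull]] := @exists_full_flag N d lam.
- move=> c /fP[_ fN]; rewrite /lam fN /= /flip.
  by case: (f c).2 (neg _) (odd (f c).1) => [] [] []; case: ifP; lia.
- move=> c e cB eB ce; apply/eqP => lam_ce.
  have [fi fb] : (f c).1 = (f e).1 /\ (f c).2 = ~~ (f e).2.
    have lam_half c' : (lam c')./2 = (f c').1.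
      by rewrite /lam; move: (_ (+) odd _) => b; rewrite addnC half_bit_double.
    have fi : (f c).1 = (f e).1.
      apply: val_inj; rewrite /= -!lam_half lam_ce /flip; case: ifP; lia.
    split => //; have := congr1 odd lam_ce.
    rewrite odd_flip /lam fi !oddD !odd_double !oddb !addFb -!addNb.
    by move=> /addIb/addIb.
  have ne : c != e.
    by apply: contraPneq fb => ->; case: (f e).2.
  have [[Qc _] [Qe _]] := (fP c cB, fP e eB).
  move: Qc Qe; rewrite /Q fi fb; case: (f e).2; rewrite /= expr0 expr1 scale1r scaleN1r.
    by apply: separated_opp => //; rewrite ce.
  move=> Qc Qe; apply: separated_opp Qe Qc => //; first by rewrite ce orbT.
  by rewrite eq_sym.
- move=> c; rewrite /lam; have := ltn_ord (f c).1.
  by move: (_ (+) odd _) => b; lia.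
have /choice[g gP] : forall i : 'I_d.+1, exists c, c \in t /\ lam c = (i.*2 + odd i)%N.
  by move=> i; have [c ct lamc] := tfull i (ltn_ord i); exists c.
have fg i : (f (g i)).1 = i /\ (f (g i)).2 = neg i.
  have := (gP i).2; rewrite /lam => e.
  have fi : (f (g i)).1 = i.
    apply: val_inj; move: e => /(congr1 half) /=.
    by rewrite ![(_.*2 + _)%N]addnC !half_bit_double.
  split => //; move: e; rewrite fi => /eqP; rewrite eqn_add2l => /eqP e.
  have := congr1 odd e; rewrite !oddb -[RHS]addFb => /addIb.
  by case: (f (g i)).2 (neg i) => [] [].
have color_inj : injective (color \o g).
  move=> i j /= ij; have [gij|gij] := eqVneq (g i) (g j).
    by rewrite -(fg i).1 gij (fg j).1.
  have [[it _] [jt _]] := (gP i, gP j).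
  have := color_neq _ _ (tB _ it) (tB _ jt) (tcmp _ _ it jt) gij.
  by rewrite ij eqxx.
(* The cells of the flag realize one point of each set F p i, within 1 / M.+1
   of the first of them. *)
have [i|i] :=
  sepFM (perm color_inj) (u (g ord0)) (fun i => u (g i)) (uK _ (tB _ (gP ord0).1)).
  have [Qg _] := fP _ (tB _ (gP i).1); move: Qg.
  rewrite /F /Q (fg i).1 (fg i).2 permE /= => Qg.
  have si : (-1) ^+ neg i = s i.
    by rewrite /neg; case: (s_sign i) => ->; rewrite ?eqxx // -subr_eq0 opprK
      -[1 + 1]/(2%:R) pnatr_eq0.
  exists (s i *: u (g i)); first by rewrite -si.
  by rewrite scalerA; case: (s_sign i) => ->; rewrite ?mulrNN mulr1 scale1r.
rewrite leNgt => /negP; apply; apply: cell_pt_close => //.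
- exact: tB (gP _).1.
- exact: tB (gP _).1.
- exact: tcmp (gP _).1 (gP _).1.
Qed.
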